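(* For every $p\geq 1$, the function $d_{\mathrm{GM},p}$ is an extended quasi-metric on $\mathcal{M}^m$. That is, for all mm-spaces $\mathcal{X},\mathcal{Y},\mathcal{Z}$: (i) $d_{\mathrm{GM},p}(\mathcal{X},\mathcal{Y})\in[0,\infty]$; (ii) $d_{\mathrm{GM},p}(\mathcal{X},\mathcal{Y})=0$ if and only if $\mathcal{X}$ and $\mathcal{Y}$ are isomorphic; (iii) $d_{\mathrm{GM},p}(\mathcal{X},\mathcal{Z})\leq d_{\mathrm{GM},p}(\mathcal{X},\mathcal{Y})+d_{\mathrm{GM},p}(\mathcal{Y},\mathcal{Z})$. In particular, $d_{\mathrm{GM},p}$ depends only on the isomorphism classes of its arguments; it may take the value $\infty$ and need not be symmetric.
   Context: A metric measure space (mm-space) is a triple $\mathcal{X}=(X,d_X,\mu_X)$ where $(X,d_X)$ is a compact metric space and $\mu_X$ is a Borel probability measure on $X$ with full support ($\mathrm{supp}[\mu_X]=X$). An isomorphism $\mathcal{X}\to\mathcal{Y}$ is a map $\phi:X\to Y$ that is an isometry and satisfies $\phi_\#\mu_X=\mu_Y$; $\mathcal{M}^m$ denotes the collection of isomorphism classes of mm-spaces. For mm-spaces $\mathcal{X},\mathcal{Y}$, let $\mathcal{T}(\mu_X,\mu_Y)$ be the set of Borel measurable maps $\phi:X\to Y$ with $\phi_\#\mu_X=\mu_Y$. For $p\in[1,\infty)$ the Gromov–Monge $p$-distance is $$d_{\mathrm{GM},p}(\mathcal{X},\mathcal{Y})=\inf_{\phi\in\mathcal{T}(\mu_X,\mu_Y)}\left(\iint_{X\times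 X}\big|d_X(x,x')-d_Y(\phi(x),\phi(x'))\big|^p\,\mu_X(dx)\,\mu_X(dx')\right)^{1/p},$$ with the convention $d_{\mathrm{GM},p}(\mathcal{X},\mathcal{Y})=\infty$ if $\mathcal{T}(\mu_X,\mu_Y)=\emptyset$. An extended quasi-metric is a function satisfying all metric axioms except symmetry and allowed to take the value $\infty$. *)

(* Defs.v *)
From HB Require Import structures.
From mathcomp Require Import all_boot all_order all_algebra.
From mathcomp Require Import all_classical all_reals all_analysis.
Set Implicit Arguments. Unset Strict Implicit. Unset Printing Implicit Defensive.
Import Order.TTheory GRing.Theory Num.Theory.
Local Open Scope classical_set_scope.
Local Open Scope ring_scope.

Section MMDefs.
Variable R : realType.

Definition is_metric (T : Type) (d : T -> T -> R) : Prop :=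
  [/\ forall x y, 0 <= d x y,
      forall x y, d x y = 0 <-> x = y,
      forall x y, d x y = d y x &
      forall x y z, d x z <= d x y + d y z].

Definition dopen (T : Type) (d : T -> T -> R) (U : set T) : Prop :=
  forall x, U x -> exists2 e : R, 0 < e & [set y | d x y < e] `<=` U.

Definition dcompact (T : Type) (d : T -> T -> R) : Prop :=
  forall (I : Type) (U : I -> set T), (forall i, dopen d (U i)) ->
    (forall x, exists i, U i x) ->
    exists (n : nat) (f : 'I_n -> I), forall x, exists j, U (f j) x.

Definition full_support (dd : measure_display) (T : measurableType dd)
  (d : T -> T -> R) (mu : set T -> \bar R) : Prop :=
  forall (x : T) (U : set T), dopen d U -> U x -> (0 < mu U)%E.

End MMDefs.

Record mmspace (R : realType) := MMSpace {
  mm_disp : measure_display;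
  mm_T : measurableType mm_disp;
  mm_d : mm_T -> mm_T -> R;
  mm_mu : probability mm_T R;
  mm_metric : is_metric mm_d;
  mm_compact : dcompact mm_d;
  mm_borel : @measurable _ mm_T = <<s [set U | dopen mm_d U] >>;
  mm_full : full_support mm_d mm_mu }.
Arguments mm_T {R} m.
Arguments mm_d {R} m.
Arguments mm_mu {R} m.

Unset Implicit Arguments.
Section GM.
Variable R : realType.

Definition mm_iso (X Y : mmspace R) (phi : mm_T X -> mm_T Y) : Prop :=
  [/\ bijective phi,
      (forall x x', mm_d Y (phi x) (phi x') = mm_d X x x') &
      (forall A, measurable A -> pushforward (mm_mu X) phi A = mm_mu Y A)].

Definition mm_isomorphic (X Y : mmspace R) : Prop :=
  exists phi : mm_T X -> mm_T Y, mm_iso X Y phi.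

Definition transport_maps (X Y : mmspace R) : set (mm_T X -> mm_T Y) :=
  [set phi | measurable_fun setT phi /\
     (forall A, measurable A -> pushforward (mm_mu X) phi A = mm_mu Y A)].

Definition gm_cost (p : R) (X Y : mmspace R) (phi : mm_T X -> mm_T Y) : \bar R :=
  (\int[mm_mu X]_x \int[mm_mu X]_x'
     ((`| mm_d X x x' - mm_d Y (phi x) (phi x') | `^ p)%:E))%E.

(* Gromov-Monge p-distance; inf over the empty set is +oo *)
Definition dGM (p : R) (X Y : mmspace R) : \bar R :=
  ereal_inf [set (gm_cost p X Y phi `^ p^-1)%E | phi in transport_maps X Y].

End GM.
Arguments mm_iso {R} X Y phi.
Arguments mm_isomorphic {R} X Y.
Arguments transport_maps {R} X Y.
Arguments gm_cost {R} p X Y phi.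
Arguments dGM {R} p X Y.

(* Main.v *)
(* Triangle inequality: costs are L^p-norms, over the product measure, of the
   distortion d_X(x, x') - d_Y(phi x, phi x'); distortions of a composition add
   up after a change of variables, so Minkowski's inequality applies.

   If the distance is 0, a measure preserving phi of small cost satisfies, for x
   in a set G of almost full measure, that few x' have a large distortion with x
   (Markov).  By compactness balls of a given radius have measure bounded below,
   so each x is close to some g x in G, and f = phi o g is defined everywhere,
   is an almost isometry, and is close to phi off a small set.  The limit psi of
   such maps f along an ultrafilter on nat is an isometry.  It preserves the
   measures because it is close to measure preserving maps off small sets, and
   it is onto because its image is closed and the measure of Y has full
   support. *)
Require Import Defs.
From HB Require Import structures.
From mathcomp Require Import all_boot all_order all_algebra.
From mathcomp Require Import all_classical all_reals all_analysis.
From mathcomp Require Import measurable_realfun.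
From mathcomp Require Import lra.
Import Order.TTheory GRing.Theory Num.Theory.
Local Open Scope classical_set_scope.
Local Open Scope ring_scope.

(** * Open sets, finite nets and measurability of the distance *)

Section Metric.
Context {R : realType}.
Implicit Type X : mmspace R.

Lemma mm_d_ge0 X x y : 0 <= mm_d X x y.
Proof. by case: (mm_metric X). Qed.

Lemma mm_dC X x y : mm_d X x y = mm_d X y x.
Proof. by case: (mm_metric X). Qed.

Lemma mm_dxx X x : mm_d X x x = 0.
Proof. by case: (mm_metric X) => _ /(_ x x)[_ ->]. Qed.

Lemma mm_d0_eq X x y : mm_d X x y = 0 -> x = y.
Proof. by case: (mm_metric X) => _ /(_ x y)[]. Qed.

Lemma mm_d_triangle X y x z : mm_d X x z <= mm_d X x y + mm_d X y z.
Proof. by case: (mm_metric X). Qed.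

Lemma dopen_ball X x r : dopen (mm_d X) [set y | mm_d X x y < r].
Proof.
move=> y /= xy; exists (r - mm_d X x y); first by rewrite subr_gt0.
move=> z /= yz; have := mm_d_triangle X y x z; lra.
Qed.

Lemma dopenI X U V :
  dopen (mm_d X) U -> dopen (mm_d X) V -> dopen (mm_d X) (U `&` V).
Proof.
move=> oU oV x [/oU[e e0 eU] /oV[f f0 fV]].
exists (Num.min e f); first by rewrite lt_min e0.
by move=> y /=; rewrite lt_min => /andP[/eU ? /fV].
Qed.

Lemma dopen_measurable X U : dopen (mm_d X) U -> measurable (U : set (mm_T X)).
Proof. by move=> oU; rewrite mm_borel; exact: sub_sigma_algebra. Qed.

Lemma mm_net X (e : R) : 0 < e ->
  exists n (f : 'I_n -> mm_T X), forall x, exists j, mm_d X (f j) x < e.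
Proof.
move=> e0; apply: (@mm_compact R X _ (fun x => [set y | mm_d X x y < e])) => x.
  exact: dopen_ball.
by exists x; rewrite /= mm_dxx.
Qed.

Lemma measurable_dist_pt X x : measurable_fun setT (mm_d X x).
Proof.
apply: (measurability _ (RGenInftyO.measurableE R)) => _ [_ [r ->] <-].
rewrite setTI; apply: dopen_measurable.
have -> : mm_d X x @^-1` `]-oo, r[ = [set y | mm_d X x y < r].
  by apply/seteqP; split => y; rewrite /= in_itv.
exact: dopen_ball.
Qed.

(* [d(f w, g w) < r] holds iff [d(f w, c) + d(c, g w) < r] for some [c] in a
   countable dense set, here the union of finite [1/(m+1)]-nets. *)
Lemma measurable_dist X d (W : measurableType d) (f g : W -> mm_T X) :
  measurable_fun setT f -> measurable_fun setT g ->
  measurable_fun setT (fun w => mm_d X (f w) (g w)).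
Proof.
move=> mf mg; apply: (measurability _ (RGenInftyO.measurableE R)).
move=> _ [_ [r ->] <-]; rewrite setTI.
have /choice[s sE] (m : nat) : exists s : {n & 'I_n -> mm_T X},
    forall x, exists j, mm_d X (tagged s j) x < m.+1%:R^-1.
  have [|n [c cE]] := @mm_net X m.+1%:R^-1; first by rewrite invr_gt0.
  by exists (Tagged (fun n => 'I_n -> mm_T X) c).
pose c (i : {m & 'I_(tag (s m))}) := tagged (s (tag i)) (tagged i).
have -> : (fun w => mm_d X (f w) (g w)) @^-1` `]-oo, r[ =
    \bigcup_i [set w | mm_d X (c i) (f w) + mm_d X (c i) (g w) < r].
  apply/seteqP; split => [w /=|w [i _ /=]]; rewrite in_itv/=; last first.
    apply: le_lt_trans; rewrite (mm_dC _ (c i)); exact: mm_d_triangle.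
  (* The detour through [c] exceeds [d(f w, g w)] by at most twice [d(c, f w)], so half of the gap
     is the right precision. *)
  move=> fgr; have e0 : 0 < (r - mm_d X (f w) (g w)) / 2.
    by rewrite divr_gt0// subr_gt0.
  have [m _ /(_ m (leqnn m))/= me] := near_infty_natSinv_lt (PosNum e0).
  have [j jf] := sE m (f w).
  exists (Tagged (fun m => 'I_(tag (s m))) j) => //=.
  have := mm_d_triangle X (f w) (tagged (s m) j) (g w).
  rewrite /c/=; move: (lt_trans jf me) => {jf me}; lra.
apply: countable_bigcupT_measurable => [|i]; first exact: countableP.
have mF : measurable_fun setT
    (fun w => mm_d X (c i) (f w) + mm_d X (c i) (g w)).
  by apply: measurable_funD;
    exact: (measurableT_comp (measurable_dist_pt X (c i))).
rewrite [X in measurable X](_ : _ = setT `&`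
    (fun w => mm_d X (c i) (f w) + mm_d X (c i) (g w)) @^-1` `]-oo, r[).
  by apply: mF => //; exact: measurable_itv.
by rewrite setTI; apply/seteqP; split => w; rewrite /= in_itv.
Qed.

End Metric.

(** * Costs as L^p-norms and the triangle inequality *)

Section Cost.
Context {R : realType}.
Implicit Types (p : R) (X Y Z : mmspace R).

Lemma transport_maps_measurable X Y phi :
  transport_maps X Y phi -> measurable_fun setT phi.
Proof. by case. Qed.

Lemma transport_maps_comp X Y Z phi chi :
  transport_maps X Y phi -> transport_maps Y Z chi ->
  transport_maps X Z (chi \o phi).
Proof.
move=> [mphi phiE] [mchi chiE]; split; first exact: measurableT_comp.
move=> A mA; rewrite -chiE// [RHS]/pushforward -phiE//.
by rewrite -[X in measurable X]setTI; exact: mchi.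
Qed.

Lemma ge0_integral_transport X Y phi (f : mm_T Y -> \bar R) :
  transport_maps X Y phi -> measurable_fun setT f -> (forall y, 0 <= f y)%E ->
  (\int[mm_mu Y]_y f y = \int[mm_mu X]_x f (phi x))%E.
Proof.
move=> [mphi phiE] mf f0.
pose mphi_mixin := isMeasurableFun.Build _ _ _ _ _ mphi.
pose mphi_pack : {mfun _ >-> _} := HB.pack phi mphi_mixin.
rewrite (@eq_measure_integral _ _ _ setT
  (pushforward (mm_mu X) mphi_pack)); last first.
  by move=> A mA _; exact/esym/phiE.
by rewrite ge0_integral_pushforward.
Qed.

Definition distortion X Y (phi : mm_T X -> mm_T Y) (z : mm_T X * mm_T X) : R :=
  mm_d X z.1 z.2 - mm_d Y (phi z.1) (phi z.2).

Lemma measurable_distortion X Y (phi : mm_T X -> mm_T Y) :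
  measurable_fun setT phi -> measurable_fun setT (distortion X Y phi).
Proof.
move=> mphi; apply: measurable_funB; apply: measurable_dist => //;
  exact: measurableT_comp.
Qed.

Lemma measurable_distortion_powR p X Y (phi : mm_T X -> mm_T Y) :
  measurable_fun setT phi ->
  measurable_fun setT (fun z => (`|distortion X Y phi z| `^ p)%:E).
Proof.
move=> mphi; apply/measurable_EFinP.
apply: (measurableT_comp (measurable_powR p)).
by apply: measurableT_comp => //; exact: measurable_distortion.
Qed.

Lemma gm_costE p X Y (phi : mm_T X -> mm_T Y) : measurable_fun setT phi ->
  gm_cost p X Y phi =
  (\int[mm_mu X \x mm_mu X]_z (`|distortion X Y phi z| `^ p)%:E)%E.
Proof.
move=> mphi; rewrite fubini_tonelli1//; exact: measurable_distortion_powR.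
Qed.

Lemma gm_cost_Lnorm p X Y (phi : mm_T X -> mm_T Y) : measurable_fun setT phi ->
  (gm_cost p X Y phi `^ p^-1 =
   'N[mm_mu X \x mm_mu X]_p%:E[EFin \o distortion X Y phi])%E.
Proof. by move=> mphi; rewrite gm_costE// unlock. Qed.

(** Change of variables in each of the two integrals; for the outer one, Tonelli gives measurability
    of the inner integral. *)
Lemma gm_cost_transport p X Y Z phi (chi : mm_T Y -> mm_T Z) :
  transport_maps X Y phi -> measurable_fun setT chi ->
  gm_cost p Y Z chi = (\int[mm_mu X]_x \int[mm_mu X]_x'
    (`|distortion Y Z chi (phi x, phi x')| `^ p)%:E)%E.
Proof.
move=> Tphi mchi; have mD := measurable_distortion_powR p Y Z chi mchi.
have D0 z : (0 <= (`|distortion Y Z chi z| `^ p)%:E)%E.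
  by rewrite lee_fin powR_ge0.
rewrite /gm_cost (ge0_integral_transport X Y phi _ Tphi).
- apply: eq_integral => x _; apply: (ge0_integral_transport X Y phi) => //.
    exact: (measurableT_comp mD (pair1_measurable _)).
- exact: (measurable_fun_fubini_tonelli_F _ mD D0).
- by move=> y; apply: integral_ge0.
Qed.

Lemma gm_cost_comp p X Y Z phi chi : 1 <= p ->
  transport_maps X Y phi -> transport_maps Y Z chi ->
  (gm_cost p X Z (chi \o phi) `^ p^-1 <=
   gm_cost p X Y phi `^ p^-1 + gm_cost p Y Z chi `^ p^-1)%E.
Proof.
move=> p1 Tphi Tchi.
have mphi := transport_maps_measurable _ _ _ Tphi.
have mchi := transport_maps_measurable _ _ _ Tchi.
(* The distortion of [chi] is pulled back along [phi], so that both norms are over the same measure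
   on the square of [X]. *)
pose psi (z : mm_T X * mm_T X) := distortion Y Z chi (phi z.1, phi z.2).
have mpsi : measurable_fun setT psi.
  have m1 := measurableT_comp mphi (@measurable_fst _ _ (mm_T X) (mm_T X)).
  have m2 := measurableT_comp mphi (@measurable_snd _ _ (mm_T X) (mm_T X)).
  by apply: measurable_funB; apply: measurable_dist => //;
    exact: (measurableT_comp mchi).
have mpsip : measurable_fun setT (fun z => (`|psi z| `^ p)%:E).
  apply/measurable_EFinP; apply: (measurableT_comp (measurable_powR p)).
  exact: (measurableT_comp (@normr_measurable _ _) mpsi).
have psip0 z : (0 <= (`|psi z| `^ p)%:E)%E by rewrite lee_fin powR_ge0.
have -> : (gm_cost p Y Z chi `^ p^-1 =
    'N[mm_mu X \x mm_mu X]_p%:E[EFin \o psi])%E.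
  rewrite (gm_cost_transport p X Y Z phi)// unlock.
  by rewrite -[X in (X `^ _)%E](fubini_tonelli1 _ mpsip psip0).
have mcp : measurable_fun setT (chi \o phi).
  exact: (measurableT_comp mchi mphi).
apply: (@le_trans _ _ ('N[mm_mu X \x mm_mu X]_p%:E[
    EFin \o (distortion X Y phi \+ psi)%R])%E).
  rewrite gm_cost_Lnorm// (_ : distortion X Z _ = distortion X Y phi \+ psi)//.
  by apply/funext => z; rewrite /distortion /psi /distortion/= addrA subrK.
apply: (le_trans (minkowski_EFin _ (measurable_distortion _ _ _ mphi) mpsi p1)).
by apply: leeD => //; rewrite gm_cost_Lnorm.
Qed.

Lemma gm_cost_ge0 p X Y (phi : mm_T X -> mm_T Y) : (0 <= gm_cost p X Y phi)%E.
Proof.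
by apply: integral_ge0 => x _; apply: integral_ge0 => y _;
  rewrite lee_fin powR_ge0.
Qed.

Lemma dGM_ge0 p X Y : (0 <= dGM p X Y)%E.
Proof. by apply: le_ereal_inf_tmp => _ [phi _ <-]; exact: poweR_ge0. Qed.

Lemma dGM_triangle p X Y Z : 1 <= p ->
  (dGM p X Z <= dGM p X Y + dGM p Y Z)%E.
Proof.
move=> p1.
(* An infinite term makes the bound trivial; the near-minimisers chosen below need finite infima. *)
have [->|XYfin] := eqVneq (dGM p X Y) +oo%E.
  by rewrite addye ?leey// -ltNye (lt_le_trans _ (dGM_ge0 _ _ _)).
have [->|YZfin] := eqVneq (dGM p Y Z) +oo%E.
  by rewrite addey ?leey// -ltNye (lt_le_trans _ (dGM_ge0 _ _ _)).
have fin X' Y' : dGM p X' Y' != +oo%E -> dGM p X' Y' \is a fin_num.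
  by move=> h; rewrite ge0_fin_numE ?ltey// dGM_ge0.
apply/lee_addgt0Pr => e e0; have e20 : 0 < e / 2 by rewrite divr_gt0.
have [_ [phi Tphi <-] phie] := lb_ereal_inf_adherent e20 (fin _ _ XYfin).
have [_ [chi Tchi <-] chie] := lb_ereal_inf_adherent e20 (fin _ _ YZfin).
apply: (@le_trans _ _ (gm_cost p X Z (chi \o phi) `^ p^-1)%E).
  apply: ereal_inf_lbound; exists (chi \o phi) => //.
  exact: transport_maps_comp Tphi Tchi.
apply: (le_trans (gm_cost_comp p X Y Z _ _ p1 Tphi Tchi)).
apply: (le_trans (leeD (ltW phie) (ltW chie))).
by rewrite addeACA -EFinD -splitr.
Qed.

End Cost.

(** * Isometries, ultrafilter limits and masses of balls *)

Section Isometry.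
Context {R : realType}.
Implicit Types (X Y : mmspace R).

Lemma isometry_measurable X Y (psi : mm_T X -> mm_T Y) :
  (forall x x', mm_d Y (psi x) (psi x') = mm_d X x x') ->
  measurable_fun setT psi.
Proof.
move=> psi_iso; apply: (measurability _ (mm_borel Y)) => _ [U oU <-].
rewrite setTI; apply: dopen_measurable => x /oU[e e0 eU].
by exists e => // y /= xy; apply: eU; rewrite /= psi_iso.
Qed.

Lemma isomorphic_dGM0 (p : R) X Y : p != 0 -> mm_isomorphic X Y ->
  dGM p X Y = 0%E.
Proof.
move=> p0 [phi [_ phi_iso phiE]]; apply/eqP; rewrite eq_le dGM_ge0 andbT.
apply: ereal_inf_lbound; exists phi.
  by split => //; exact: isometry_measurable phi_iso.
(* Zero to the power 0 is 1, so [p != 0] serves both the integrand and the outer exponent [p^-1]. *)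
rewrite (_ : gm_cost p X Y phi = 0%E) ?poweR0r// ?invr_eq0//.
rewrite /gm_cost integral0_eq// => x _; rewrite integral0_eq// => x' _.
by rewrite phi_iso subrr normr0 powR0.
Qed.

(** Otherwise every point has a ball whose index set is not in [F]. Finitely many such balls cover
    [X], and the complements of their index sets lie in [F], so some [u k] avoids them all. *)
Lemma ultra_lim X (F : set_system nat) (u : nat -> mm_T X) : UltraFilter F ->
  exists y, forall e : R, 0 < e -> F [set n | mm_d X (u n) y < e].
Proof.
move=> UF; apply: contrapT => /forallNP nolim.
have /choice[e eP] (y : mm_T X) :
    exists e : R, 0 < e /\ ~ F [set n | mm_d X (u n) y < e].
  have /existsNP[e /not_implyP[e0 eF]] := nolim y.
  by exists e.
have [|x|n [f fP]] := @mm_compact R X _ (fun y => [set z | mm_d X y z < e y]).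
- by move=> y; exact: dopen_ball.
- by exists x => /=; rewrite mm_dxx; case: (eP x).
have FC (j : 'I_n) : F (~` [set n | mm_d X (u n) (f j) < e (f j)]).
  have [//|//] := in_ultra_setVsetC [set n | mm_d X (u n) (f j) < e (f j)] UF.
  by case: (eP (f j)).
have /filter_ex[k kP] :
    F [set k | forall j, ~ mm_d X (u k) (f j) < e (f j)].
  exact: filter_forall.
by have [j] := fP (u k); rewrite /= mm_dC => /(kP j).
Qed.

Lemma isometry_surjective X Y (psi : mm_T X -> mm_T Y) :
  (forall x x', mm_d Y (psi x) (psi x') = mm_d X x x') ->
  (forall A, measurable A -> pushforward (mm_mu X) psi A = mm_mu Y A) ->
  forall y, exists x, psi x = y.
Proof.
move=> psi_iso psiE y; apply: contrapT => /forallNP yN.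
have d0 x : 0 < mm_d Y y (psi x).
  rewrite lt_neqAle mm_d_ge0 andbT eq_sym; apply/eqP => /mm_d0_eq yx.
  exact: (yN x).
(* These open sets grow with [k], so a finite subcover bounds the distance from [y] to the image
   away from 0. A ball around [y] then has empty preimage, hence mass 0, against full support. *)
have [|x|n [f fP]] := @mm_compact R X _
    (fun k : nat => [set x | k.+1%:R^-1 < mm_d Y y (psi x)]).
- move=> k x /=; set r := _^-1 => rx; exists (mm_d Y y (psi x) - r).
    by rewrite subr_gt0.
  move=> x' /=; rewrite -psi_iso.
  have := mm_d_triangle Y (psi x') y (psi x).
  rewrite (mm_dC Y (psi x')); lra.
- have [k _ /(_ k (leqnn k)) kP] := near_infty_natSinv_lt (PosNum (d0 x)).
  by exists k.
pose m := \max_(j < n) f j.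
have mP x : m.+1%:R^-1 < mm_d Y y (psi x).
  have [j] := fP x; apply: le_lt_trans.
  by rewrite lef_pV2 ?posrE// ler_nat ltnS leq_bigmax.
have := mm_full (dopen_ball Y y m.+1%:R^-1).
rewrite -psiE; last exact/dopen_measurable/dopen_ball.
rewrite /pushforward (_ : _ @^-1` _ = set0) ?measure0/=; last first.
  apply/seteqP; split => // x /= /(lt_trans (mP x)).
  by rewrite ltxx.
by move=> /(_ y); rewrite ltxx mm_dxx invr_gt0 ltr0n => /(_ isT).
Qed.

(** Every ball of radius [e] contains a ball of radius [e / 2] around a point of a finite net, and
    these finitely many balls have positive mass by full support. *)
Lemma ball_measure_lower_bound X (e : R) : 0 < e ->
  exists2 c : R, 0 < c &
    forall x, (c%:E <= mm_mu X [set y | (mm_d X x y < e)%R])%E.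
Proof.
move=> e0; have [|n [f fP]] := @mm_net R X (e / 2); first by rewrite divr_gt0.
pose B j := [set y | mm_d X (f j) y < e / 2].
have mB j : measurable (B j) by exact/dopen_measurable/dopen_ball.
pose c := \big[Num.min/1]_(j < n) fine (mm_mu X (B j)).
exists c.
  apply/bigmin_gtP; split => // j _; apply: fine_gt0; apply/andP; split.
    have := mm_full (dopen_ball X (f j) (e / 2)).
    by move=> /(_ (f j)); apply; rewrite /= mm_dxx divr_gt0.
  by rewrite -ge0_fin_numE// fin_num_measure.
move=> x; have [j jx] := fP x.
apply: (@le_trans _ _ (mm_mu X (B j))).
  rewrite -[leRHS]fineK ?fin_num_measure// lee_fin.
  exact: bigmin_le_cond.
apply: le_measure; rewrite ?inE//; first exact/dopen_measurable/dopen_ball.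
move=> y /=; rewrite /B/= => jy.
by have := mm_d_triangle X (f j) x y; rewrite (mm_dC X x (f j)); lra.
Qed.

(** Serves to pick, in a ball of mass bounded below, a point avoiding a small exceptional set. *)
Lemma measure_lt_notin d (T : measurableType d) (mu : {measure set T -> \bar R})
    (A B : set T) : measurable A -> measurable B -> (mu A < mu B)%E ->
  exists2 x, B x & ~ A x.
Proof.
move=> mA mB AB; apply: contrapT => /forall2NP BA.
move: AB; rewrite ltNge le_measure ?inE// => x Bx.
by case: (BA x) => // /contrapT.
Qed.

End Isometry.

(** * Maps of small cost and their exceptional sets *)

Section Approximation.
Context {R : realType}.
Implicit Types (X Y : mmspace R) (p e : R).

Lemma dGM0_cost_lt p X Y e : 1 <= p -> dGM p X Y = 0%E -> 0 < e ->
  exists2 phi, transport_maps X Y phi & (gm_cost p X Y phi < e%:E)%E.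
Proof.
move=> p1 d0 e0; have ep0 : 0 < e `^ p^-1 by rewrite powR_gt0.
have pV0 : 0 <= p^-1 by rewrite invr_ge0 (le_trans ler01).
have dfin : dGM p X Y \is a fin_num by rewrite d0.
have [_ [phi Tphi <-]] := lb_ereal_inf_adherent ep0 dfin.
rewrite -/(dGM p X Y) d0 add0e => phie; exists phi => //.
rewrite ltNge; apply/negP => ecost.
have : (e%:E `^ p^-1 <= gm_cost p X Y phi `^ p^-1)%E.
  by apply: gt0_ler_poweR => //; rewrite in_itv/= ?leey ?lee_fin ?(ltW e0)//
    gm_cost_ge0.
by rewrite leNgt phie.
Qed.

Definition distorted X Y (phi : mm_T X -> mm_T Y) e x : set (mm_T X) :=
  [set x' | e <= `|distortion X Y phi (x, x')|].

Lemma distorted_measurable X Y (phi : mm_T X -> mm_T Y) e x :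
  measurable_fun setT phi -> measurable (distorted X Y phi e x).
Proof.
move=> mphi.
have mD : measurable_fun setT (fun x' => `|distortion X Y phi (x, x')|).
  apply: (measurableT_comp (@normr_measurable _ _)).
  exact: (measurableT_comp (measurable_distortion X Y phi mphi)
    (pair1_measurable _)).
have := mD measurableT _ (measurable_itv `[e, +oo[); rewrite setTI.
congr (measurable _); apply/seteqP.
by split => y; rewrite /= in_itv/= andbT.
Qed.

Lemma dGM0_few_distorted p X Y e : 1 <= p -> dGM p X Y = 0%E -> 0 < e ->
  exists phi G, [/\ transport_maps X Y phi, measurable G,
    (mm_mu X (~` G) <= e%:E)%E &
    forall x, G x -> (mm_mu X (distorted X Y phi e x) <= e%:E)%E].
Proof.
move=> p1 d0 e0; have p0 : 0 <= p by rewrite (le_trans ler01).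
have ep0 : 0 < e `^ p by rewrite powR_gt0.
have s0 : 0 < e `^ p * e by rewrite mulr_gt0.
(* Markov's inequality is used twice: on the inner integral [h] at level e^p e, which leaves mass
   [e] for the bad [x], then on the integrand at level e^p, which leaves mass [e] for the bad
   [x']. *)
have [phi Tphi phie] :=
  dGM0_cost_lt p X Y (e `^ p * e * e) p1 d0 (mulr_gt0 s0 e0).
have mphi := transport_maps_measurable _ _ _ Tphi.
have mD := measurable_distortion_powR p X Y phi mphi.
have D0 z : (0 <= (`|distortion X Y phi z| `^ p)%:E)%E.
  by rewrite lee_fin powR_ge0.
pose h x := (\int[mm_mu X]_x' (`|distortion X Y phi (x, x')| `^ p)%:E)%E.
have h0 x : (0 <= h x)%E by apply: integral_ge0.
have mh : measurable_fun setT h by exact: measurable_fun_fubini_tonelli_F mD D0.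
pose B := setT `&` [set x | ((e `^ p * e)%:E <= `|h x|)%E].
exists phi, (~` B); split => //.
- apply: measurableC; apply: emeasurable_fun_c_infty => //.
  exact: measurableT_comp.
- rewrite setCK -(@lee_pmul2l _ (e `^ p * e)%:E) ?lte_fin//.
  apply: (le_trans (le_integral_abse _ measurableT mh s0)).
  rewrite -EFinM; apply: le_trans (ltW phie); rewrite le_eqVlt; apply/orP; left.
  by apply/eqP/eq_integral => x _; rewrite gee0_abs.
move=> x /not_andP[/(_ Logic.I)//|/= /negP]; rewrite -ltNge gee0_abs// => hx.
have mDx : measurable_fun setT
    (fun x' => (`|distortion X Y phi (x, x')| `^ p)%:E).
  exact: (measurableT_comp mD (pair1_measurable _)).
rewrite -(@lee_pmul2l _ (e `^ p)%:E) ?lte_fin//.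
apply: (@le_trans _ _ (h x)); last by rewrite -EFinM ltW.
have := le_integral_abse (mm_mu X) measurableT mDx ep0.
under eq_integral do rewrite gee0_abs//.
apply: le_trans; rewrite lee_pmul2l ?lte_fin//.
apply: le_measure; rewrite ?inE.
- exact: distorted_measurable.
- by apply: emeasurable_fun_c_infty => //; exact: measurableT_comp.
- move=> x' /= ex'; split => //; rewrite lee_fin ger0_norm ?powR_ge0//.
  by apply: ge0_ler_powR => //; rewrite nnegrE// ltW.
Qed.

Lemma measureU_le d (T : measurableType d) (mu : {measure set T -> \bar R})
    (A B : set T) : measurable A -> measurable B ->
  (mu (A `|` B) <= mu A + mu B)%E.
Proof.
move=> mA mB; have mD : measurable ((A `|` B) `\` A).
  by apply: measurableD => //; exact: measurableU.
rewrite -(setDUK (@subsetUl _ A B)) measureU//; last by rewrite setDIK.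
rewrite leeD2l// le_measure ?inE// => x [[Ax|//]].
by move=> /(_ Ax).
Qed.

Lemma measure_bigsetU_le d (T : measurableType d)
    (mu : {measure set T -> \bar R}) n (B : 'I_n -> set T) (e : R) :
  (forall j, measurable (B j)) -> (forall j, mu (B j) <= e%:E)%E ->
  (mu (\big[setU/set0]_(j < n) B j) <= (n%:R * e)%:E)%E.
Proof.
move=> mB Be; rewrite (_ : (n%:R * e)%:E = \sum_(j < n) e%:E)%E; last first.
  by rewrite sumEFin sumr_const card_ord mulr_natl.
suff [] : measurable (\big[setU/set0]_(j < n) B j) /\
  (mu (\big[setU/set0]_(j < n) B j) <= \sum_(j < n) e%:E)%E by [].
elim/big_ind2 : _ => //; first by rewrite measure0.
move=> S s S' s' [mS Ss] [mS' Ss']; split; first exact: measurableU.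
exact: le_trans (measureU_le _ _ _ _ _ mS mS') (leeD Ss Ss').
Qed.

End Approximation.

(** * Near isometries and their limit *)

Section Limit.
Context {R : realType}.
Implicit Types (X Y : mmspace R) (p e : R).

Lemma dGM0_near_isometry p X Y e : 1 <= p -> dGM p X Y = 0%E -> 0 < e ->
  exists (phi f : mm_T X -> mm_T Y) (B : set (mm_T X)),
    [/\ transport_maps X Y phi,
      forall x x', `|mm_d Y (f x) (f x') - mm_d X x x'| < e,
      measurable B, (mm_mu X B <= e%:E)%E &
      forall x, ~ B x -> mm_d Y (phi x) (f x) < e].
Proof.
(* [phi \o g] will distort distances by less than [6 * t] and lie within [3 * t + 7 * t] of [phi]
   off the bad set, hence the 10. *)
move=> p1 d0 e0; pose t := e / 10.
have t0 : 0 < t by rewrite divr_gt0.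
have [m [c cP]] := mm_net X t t0.
have [b b0 bP] := ball_measure_lower_bound X t t0.
(* The bound [b / 3] keeps the mass of two exceptional sets below that of a ball; [e / m.+1%:R]
   keeps the union of [m] of them below [e], also when [m] is 0. *)
pose eps := Num.min t (Num.min (b / 3) (e / m.+1%:R)).
have eps0 : 0 < eps by rewrite !lt_min t0 !divr_gt0.
have epst : eps <= t by rewrite ge_min lexx.
have epsb : eps <= b / 3 by rewrite !ge_min lexx orbT.
have epse : eps <= e / m.+1%:R by rewrite !ge_min lexx !orbT.
have [phi [G [Tphi mG muG Gdist]]] := dGM0_few_distorted p X Y eps p1 d0 eps0.
have mphi := transport_maps_measurable _ _ _ Tphi.
have mball x r : measurable [set y | mm_d X x y < r].
  exact/dopen_measurable/dopen_ball.
have mdist x := distorted_measurable X Y phi eps x mphi.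
have /choice[g gP] x : exists g, G g /\ mm_d X x g < t.
  have [||y xy Gy] := measure_lt_notin _ _ (mm_mu X) (~` G) _ _ (mball x t).
  - exact: measurableC.
  - apply: (le_lt_trans muG); apply: lt_le_trans (bP x).
    by rewrite lte_fin; lra.
  - by exists y; split => //; apply: contrapT.
have undistorted x z : ~ distorted X Y phi eps (g x) z ->
    `|mm_d X (g x) z - mm_d Y (phi (g x)) (phi z)| < eps.
  by move=> /negP; rewrite -ltNge.
have near_iso x x' :
    `|mm_d Y (phi (g x)) (phi (g x')) - mm_d X x x'| < 6 * t.
  (* Some [z] near [x'] is undistorted with both [g x] and [g x']. Then [phi z] is within [3 * t] of
     [phi (g x')], and its distance to [phi (g x)] is within [3 * t] of [mm_d X x x']. *)
  pose D := distorted X Y phi eps (g x) `|` distorted X Y phi eps (g x').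
  have mD : measurable D by exact: measurableU.
  have [|z x'z /not_orP[/undistorted xz /undistorted xz']] :=
      measure_lt_notin _ _ (mm_mu X) D _ mD (mball x' t).
    apply: (@le_lt_trans _ _ (eps%:E + eps%:E)%E).
      apply: (le_trans (measureU_le _ _ _ _ _ (mdist _) (mdist _))).
      by apply: leeD; apply: Gdist; case: (gP x); case: (gP x').
    by apply: lt_le_trans (bP x'); rewrite -EFinD lte_fin; lra.
  have [_ gx] := gP x; have [_ gx'] := gP x'; move: x'z => /= x'z.
  have T1 := mm_d_triangle Y (phi z) (phi (g x)) (phi (g x')).
  have T2 := mm_d_triangle Y (phi (g x')) (phi (g x)) (phi z).
  have T3 := mm_d_triangle X x' (g x') z.
  have T4 := mm_d_triangle X (g x) x x'.
  have T5 := mm_d_triangle X z (g x) x'.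
  have T6 := mm_d_triangle X x (g x) z.
  have T7 := mm_d_triangle X x' x z.
  rewrite (mm_dC Y (phi z)) in T1; rewrite (mm_dC X (g x') x') in T3.
  rewrite (mm_dC X z) in T5; rewrite (mm_dC X (g x) x) in T6.
  move: xz xz'; rewrite !ltr_norml => /andP[? ?] /andP[? ?].
  by apply/andP; split; lra.
exists phi, (phi \o g),
  (\big[setU/set0]_(j < m) distorted X Y phi eps (g (c j))); split => //.
- by move=> x x'; apply: (lt_le_trans (near_iso x x')); rewrite /t; lra.
- by apply: bigsetU_measurable => j _.
- apply: (le_trans (measure_bigsetU_le _ _ _ _ _ eps _ _)) => //.
    by move=> j; apply: Gdist; case: (gP (c j)).
  rewrite lee_fin (@le_trans _ _ (m.+1%:R * eps))//.
    by rewrite ler_wpM2r ?ler_nat// ltW.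
  by rewrite mulrC -ler_pdivlMr.
move=> x xB.
(* The path from [phi x] to [phi (g x)] goes through [phi (g (c j))]: less than [3 * t] since [x] is
   undistorted with [g (c j)], then less than [7 * t] by [near_iso]. *)
have [j jx] := cP x.
have /undistorted jxd : ~ distorted X Y phi eps (g (c j)) x.
  by move=> h; apply: xB; rewrite (bigD1 j)//=; left.
have [_ gj] := gP (c j); have := near_iso (c j) x => /=.
have T1 := mm_d_triangle Y (phi (g (c j))) (phi x) (phi (g x)).
have T2 := mm_d_triangle X (c j) (g (c j)) x.
rewrite (mm_dC Y (phi x) (phi (g (c j)))) in T1.
rewrite (mm_dC X (g (c j)) (c j)) in T2.
move: jxd; rewrite !ltr_norml => /andP[? ?] /andP[? ?].
have : e = 10 * t by rewrite /t; lra.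
lra.
Qed.

(** The erosion of [U] by [e]; a radius strictly above [e] makes it open, hence measurable. *)
Definition thinning X e (U : set (mm_T X)) : set (mm_T X) :=
  [set y | exists2 r, e < r & [set z | mm_d X y z < r] `<=` U].

Lemma dopen_thinning X e U : dopen (mm_d X) (thinning X e U).
Proof.
move=> y [r er rU]; exists ((r - e) / 2); first by rewrite divr_gt0// subr_gt0.
move=> z /= yz; exists ((r + e) / 2); first lra.
by move=> w /= zw; apply: rU => /=; have := mm_d_triangle X z y w; lra.
Qed.

(** The thinnings of an open set increase to it as [e] decreases to 0, so continuity from below
    applies. *)
Lemma le_measure_thinning X (mu : {measure set (mm_T X) -> \bar R}) U
    (a : \bar R) : dopen (mm_d X) U ->
  (forall e, 0 < e -> (mu (thinning X e U) <= a + e%:E)%E) -> (mu U <= a)%E.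
Proof.
move=> oU aU; pose F (n : nat) := thinning X n.+1%:R^-1 U.
have mF n : measurable (F n) by exact/dopen_measurable/dopen_thinning.
have FU : \bigcup_n F n = U.
  apply/seteqP; split => [y [n _ [r nr rU]]|y /oU[r r0 rU]].
    by apply: rU; rewrite /= mm_dxx (lt_trans _ nr)// invr_gt0.
  have [n _ /(_ n (leqnn n)) nr] := near_infty_natSinv_lt (PosNum r0).
  by exists n => //; exists r.
have ndF : nondecreasing_seq F.
  move=> n m nm; apply/subsetPset => y [r nr rU]; exists r => //.
  by apply: le_lt_trans nr; rewrite lef_pV2 ?posrE// ler_nat ltnS.
have cvgF : (mu \o F) n @[n --> \oo] --> mu U.
  rewrite -FU; apply: nondecreasing_cvg_mu => //.
  by rewrite FU; exact: dopen_measurable.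
apply/lee_addgt0Pr => e e0; apply: (cvge_to_le cvgF).
near=> n; apply: (le_trans (aU _ _)); first by rewrite invr_gt0.
rewrite leeD2l// lee_fin ltW//; near: n.
exact: (near_infty_natSinv_lt (PosNum e0)).
Unshelve. all: by end_near. Qed.

Lemma le_measure_near_maps X Y (f g : mm_T X -> mm_T Y) (B : set (mm_T X))
    e U : measurable_fun setT f -> measurable_fun setT g -> measurable B ->
  dopen (mm_d Y) U -> (forall x, ~ B x -> mm_d Y (f x) (g x) < e) ->
  (mm_mu X (f @^-1` thinning Y e U) <= mm_mu X (g @^-1` U) + mm_mu X B)%E.
Proof.
move=> mf mg mB oU fg.
have pre h V : measurable_fun setT h -> dopen (mm_d Y) V ->
    measurable (h @^-1` V : set (mm_T X)).
  by move=> mh oV; rewrite -[X in measurable X]setTI; apply: mh => //;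
    exact: dopen_measurable.
have mgU := pre _ _ mg oU.
apply: le_trans (measureU_le _ _ (mm_mu X) _ _ mgU mB).
apply: le_measure; rewrite ?inE.
- by apply: pre => //; exact: dopen_thinning.
- exact: measurableU.
move=> x [r er rU]; have [Bx|nBx] := pselect (B x); [by right|left].
by apply: rU => /=; exact: lt_trans (fg _ nBx) er.
Qed.

Lemma eq_lee (x y : \bar R) : x = y -> (x <= y)%E.
Proof. by move=> ->. Qed.

(** On open sets, comparing [psi] with [phi] in both directions through thinnings gives both
    inequalities. Open sets are stable under intersection and generate the sigma-algebra, so the
    measures agree. *)
Lemma near_transport_maps X Y (psi : mm_T X -> mm_T Y) :
  measurable_fun setT psi ->
  (forall e, 0 < e -> exists phi B, [/\ transport_maps X Y phi, measurable B,
    (mm_mu X B <= e%:E)%E & forall x, ~ B x -> mm_d Y (phi x) (psi x) < e]) ->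
  forall A, measurable A -> pushforward (mm_mu X) psi A = mm_mu Y A.
Proof.
move=> mpsi near_psi A mA.
pose psi_mixin := isMeasurableFun.Build _ _ _ _ _ mpsi.
pose psi_pack : {mfun _ >-> _} := HB.pack psi psi_mixin.
apply: (measure_unique [set U | dopen (mm_d Y) U] (fun=> setT) _ _ _ _
  (pushforward (mm_mu X) psi_pack) (mm_mu Y)) => //.
- exact: mm_borel.
- exact: dopenI.
- by move=> _ x _; exists 1.
- by apply/seteqP; split => // x _; exists 0%N.
- move=> U oU; apply/eqP; rewrite eq_le; apply/andP; split.
    apply: le_measure_thinning => // e e0.
    have [phi [B [[mphi phiE] mB Be phipsi]]] := near_psi e e0.
    have psiphi x : ~ B x -> mm_d Y (psi x) (phi x) < e.
      by rewrite mm_dC; exact: phipsi.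
    have := le_measure_near_maps X Y _ _ B e U mpsi mphi mB oU psiphi.
    move=> /le_trans; apply.
    by apply: leeD => //; apply/eq_lee/phiE; exact: dopen_measurable.
  apply: le_measure_thinning => // e e0.
  have [phi [B [[mphi phiE] mB Be phipsi]]] := near_psi e e0.
  have phiV := phiE _ (dopen_measurable _ _ (dopen_thinning Y e U)).
  apply: (@le_trans _ _ (mm_mu X (phi @^-1` thinning Y e U))).
    exact/eq_lee/esym.
  have := le_measure_near_maps X Y _ _ B e U mphi mpsi mB oU phipsi.
  move=> /le_trans; apply.
  by rewrite leeD2l.
- by move=> _; rewrite -[ltLHS]/(mm_mu X setT) probability_setT ltry.
Qed.

Lemma dGM0_isomorphic p X Y : 1 <= p -> dGM p X Y = 0%E -> mm_isomorphic X Y.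
Proof.
move=> p1 d0.
have /choice[phi /choice[f /choice[B fB]]] (n : nat) :=
  dGM0_near_isometry p X Y n.+1%:R^-1 p1 d0 (ltac:(by rewrite invr_gt0)).
(* An ultrafilter containing the tails of [nat] yields limits at all points of [X] at once, without
   extracting subsequences. *)
have [F [UF ooF]] := ultraFilterLemma (@eventually_filter).
have /choice[psi psiP] x := ultra_lim Y F (f ^~ x) UF.
have small e : 0 < e -> F [set n | n.+1%:R^-1 < e].
  by move=> e0; apply: ooF; exact: (near_infty_natSinv_lt (PosNum e0)).
have psi_iso x x' : mm_d Y (psi x) (psi x') = mm_d X x x'.
  apply/eqP; rewrite -subr_eq0 -normr_le0; apply/ler_addgt0Pr => e e0.
  have e30 : 0 < e / 3 by rewrite divr_gt0.
  have /filter_ex[n [/= nx [nx' ne]]] :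
      F ([set n | mm_d Y (f n x) (psi x) < e / 3] `&`
      ([set n | mm_d Y (f n x') (psi x') < e / 3] `&`
       [set n | n.+1%:R^-1 < e / 3])).
    by apply: filterI; [exact: psiP|apply: filterI; [exact: psiP|exact: small]].
  have [_ /(_ x x') fxx' _ _ _] := fB n.
  have T1 := mm_d_triangle Y (f n x) (psi x) (psi x').
  have T2 := mm_d_triangle Y (f n x') (f n x) (psi x').
  have T3 := mm_d_triangle Y (psi x) (f n x) (f n x').
  have T4 := mm_d_triangle Y (psi x') (psi x) (f n x').
  rewrite (mm_dC Y (psi x) (f n x)) in T1.
  rewrite (mm_dC Y (psi x') (f n x')) in T4.
  move: (lt_trans fxx' ne); rewrite ltr_norml ler_norml => /andP[? ?].
  by apply/andP; split; lra.
have mpsi := isometry_measurable X Y psi psi_iso.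
have psiE : forall A, measurable A ->
    pushforward (mm_mu X) psi A = mm_mu Y A.
  apply: near_transport_maps => // e e0.
  (* Five errors link [phi n x] to [psi x]: from [phi n x] to [f n x], two from there to
     [f n (c j)], then to [psi (c j)] and to [psi x]. The filter controls only finitely many points
     at once, hence the net. *)
  have t0 : 0 < e / 5 by rewrite divr_gt0.
  have [m [c cP]] := mm_net X (e / 5) t0.
  have /filter_ex[n [/= ne nc]] :
      F ([set n | n.+1%:R^-1 < e / 5] `&`
         [set n | forall j, mm_d Y (f n (c j)) (psi (c j)) < e / 5]).
    by apply: filterI; [exact: small|apply: filter_forall => j; exact: psiP].
  have [Tphi fiso mB muB phif] := fB n.
  exists (phi n), (B n); split => //.
    by apply: (le_trans muB); rewrite lee_fin (le_trans (ltW ne))//; lra.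
  move=> x /phif /lt_trans/(_ ne) phifx; have [j jx] := cP x.
  have := lt_trans (fiso (c j) x) ne.
  have T1 := mm_d_triangle Y (f n x) (phi n x) (psi x).
  have T2 := mm_d_triangle Y (f n (c j)) (f n x) (psi x).
  have T3 := mm_d_triangle Y (psi (c j)) (f n (c j)) (psi x).
  rewrite (mm_dC Y (f n x) (f n (c j))) in T2.
  rewrite psi_iso in T3; have := nc j.
  by rewrite ltr_norml => ? /andP[? ?]; lra.
exists psi; split => //.
(* Surjectivity gives a right inverse, which is also a left inverse because an isometry is
   injective. *)
have /choice[psi' psiK] := isometry_surjective X Y psi psi_iso psiE.
exists psi' => // x; apply: mm_d0_eq.
by rewrite -psi_iso psiK mm_dxx.
Qed.

End Limit.

Theorem theorem2p1 (R : realType) (p : R) (hp : 1 <= p) (X Y Z : mmspace R) :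
  [/\ (0 <= dGM p X Y)%E,
      dGM p X Y = 0%E <-> mm_isomorphic X Y &
      (dGM p X Z <= dGM p X Y + dGM p Y Z)%E].
Proof.
split; [exact: dGM_ge0| |exact: dGM_triangle].
split; first exact: dGM0_isomorphic.
by apply: isomorphic_dGM0; rewrite gt_eqF// (lt_le_trans ltr01).
Qed.
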